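(* Let $\varepsilon>0$, put $\theta_\varepsilon=\varepsilon/(1+\varepsilon)$, and suppose that $m\ge2$ is Wieferich-supported and $E_\varepsilon(\mathcal{V}_m)\ge0$. Put $D=D_m$. If $D=m$, then $m$ is order-saturated. If $D<m$ and $$2^{\theta_\varepsilon(m-D)}\ \ge\ m\,\frac{1-2^{-D}}{1-2^{-m}},$$ then $E_\varepsilon(\mathcal{V}_D)\ge0$. In particular, (for $D<m$) the simpler condition $2^{\theta_\varepsilon(m-D)}\ge m$ is sufficient. Moreover, for every fixed $\varepsilon>0$ the following two statements are equivalent. (1) There are infinitely many $m$ such that $E_\varepsilon(\mathcal{V}_m)\ge0$. (2) There are infinitely many order-saturated $n$ such that $E_\varepsilon(\mathcal{V}_n)\ge0$. Thus any infinite transgressive Mersenne family may be replaced, at the same exponent $\varepsilon$, by an infinite family satisfying $D_n=n$.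
   Context: For $m\ge2$, $\mathcal{V}_m=(1,2^m-1,2^m)$. For a triple $(a,b,c)$ of positive integers with $a+b=c$, $E_\varepsilon(a,b,c)=\log c-(1+\varepsilon)\log\mathrm{rad}(abc)$, where $\mathrm{rad}(n)$ is the product of the distinct primes dividing $n$; the triple is transgressive at exponent $\varepsilon$ if $E_\varepsilon\ge0$. For an odd prime $p$, $d_p$ is the multiplicative order of $2$ modulo $p$. $\mathcal{W}$ is the set of Wieferich primes, i.e. odd primes $p$ with $2^{p-1}\equiv1\pmod{p^2}$, and $\mathcal{W}(m)=\{p\in\mathcal{W}:p\mid2^m-1\}$. The order core of $m\ge2$ is $D_m=\mathrm{lcm}_{p\in\mathcal{W}(m)}d_p$ (with $D_m=1$ if $\mathcal{W}(m)=\varnothing$); it divides $m$. The exponent $m$ is Wieferich-supported when $\mathcal{W}(m)\ne\varnothing$, and order-saturated when $D_m=m$. *)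

(* Defs.v *)
From HB Require Import structures.
From mathcomp Require Import all_boot all_order all_fingroup all_algebra.
From mathcomp Require Import all_classical all_reals all_analysis.

Set Implicit Arguments.
Unset Strict Implicit.
Unset Printing Implicit Defensive.

Import Order.TTheory GRing.Theory Num.Theory.

Local Open Scope ring_scope.

Definition rad (n : nat) : nat := (\prod_(p <- primes n) p)%N.

Definition mersenne_triple (m : nat) : nat * nat * nat :=
  (1, 2 ^ m - 1, 2 ^ m)%N.

Definition excess (R : realType) (eps : R) (t : nat * nat * nat) : R :=
  let: (a, b, c) := t in
  ln (c%:R : R) - (1 + eps) * ln ((rad (a * b * c))%:R : R).

(* Order of 2 in the unit group of 'Z_p; the default value 1 of insubd is only
   reached when 2 is not invertible, hence never for an odd prime p. *)
Definition ord2 (p : nat) : nat :=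
  #[insubd (1%g : {unit 'Z_p}) (2%:R : 'Z_p)]%g.

Definition wieferich (p : nat) : bool :=
  [&& prime p, odd p & 2 ^ (p - 1) == 1 %[mod p ^ 2]]%N.

Definition wieferich_divisors (m : nat) : seq nat :=
  [seq p <- primes (2 ^ m - 1) | wieferich p].

Definition order_core (m : nat) : nat :=
  \big[lcmn/1%N]_(p <- wieferich_divisors m) ord2 p.

Definition wieferich_supported (m : nat) : Prop :=
  wieferich_divisors m <> [::].

Definition order_saturated (m : nat) : Prop := order_core m = m.

(* Main.v *)
Require Import Defs.
From HB Require Import structures.
From mathcomp Require Import all_boot all_order all_fingroup all_algebra.
From mathcomp Require Import all_classical all_reals all_analysis.
From mathcomp Require Import cyclic.
From mathcomp Require Import zify ring lra.

(** Write M(n) = 2^n - 1, F(n) = M(n) / rad M(n) for its nonradical part, and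
    let D be the order core of m. Everything rests on the inequality
    F(m) <= m F(D), proved as the divisibility [nonradical_part_dvd], one prime
    p dividing M(m) at a time:
    - if p divides M(D), lifting the exponent gives
      v_p(M(m)) = v_p(M(D)) + v_p(m/D);
    - otherwise p is not a Wieferich prime, because the orders of 2 modulo the
      Wieferich primes dividing M(m) all divide D. Then p divides M(p-1) exactly
      once, and lifting the exponent from p-1 to (p-1)m gives
      v_p(M(m)) <= 1 + v_p(m).
    So p contributes to F(m) at most its contribution to F(D) times p^v_p(m).

    With theta = eps/(1+eps), nonnegative excess at n says
    F(n) >= 2^(theta n) * 2 * (1 - 2^-n). Passing from m to D divides F by at
    most m, while the right-hand side drops by the factor
    2^(theta(m-D)) (1-2^-m) / (1-2^-D); comparing the two losses is exactly the
    stated criterion ([excess_core_ge0]).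

    Two further facts give the equivalence. The core is saturated, since m and D
    have the same Wieferich divisors ([order_core_saturated]). And D tends to
    infinity along transgressive m: F(D) < 2^D, F(m) >= 2^(theta m) and
    F(m) <= m F(D) force D >= theta m - log_2 m ([transgressive_core_growth]).
    For large m, either D = m, or D is a proper divisor, so that m - D >= m/2 and
    the criterion 2^(theta(m-D)) >= m holds. Either way D is saturated,
    transgressive and arbitrarily large. *)

Import Order.TTheory GRing.Theory Num.Theory.

(** * Lifting the exponent *)

Lemma expnB1_dvd (x k m : nat) : k %| m -> x ^ k - 1 %| x ^ m - 1.
Proof.
by case/dvdnP=> j ->; rewrite mulnC expnM -{2}(exp1n j) subn_exp dvdn_mulr.
Qed.

Lemma expn_eq1_mod (p x i : nat) : 0 < x -> p %| x - 1 -> x ^ i = 1 %[mod p].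
Proof.
move=> x_gt0 px; have x1 : x = 1 %[mod p] by apply/eqP; rewrite eqn_mod_dvd.
by rewrite -modnXm x1 modnXm exp1n.
Qed.

Lemma geom_sum_mod (p x j : nat) : 0 < x -> p %| x - 1 ->
  \sum_(i < j) x ^ i = j %[mod p].
Proof.
move=> x_gt0 px; rewrite -modn_summ.
under eq_bigr => i _ do rewrite (expn_eq1_mod p x i x_gt0 px).
by rewrite modn_summ sum_nat_const card_ord muln1.
Qed.

(** Modulo p^2 the powers of x = 1 + py are linear in the exponent, so the sum is
    p + py * p(p-1)/2; since p is odd, p divides p(p-1)/2 and the sum is
    congruent to p. *)
Lemma geom_sum_logn_prime (p x : nat) :
  prime p -> odd p -> 0 < x -> p %| x - 1 ->
  logn p (\sum_(i < p) x ^ i) = 1.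
Proof.
move=> p_pr p_odd x_gt0 /dvdnP[y xE].
have {}xE : x = 1 + p * y by rewrite mulnC -xE subnKC.
have p_gt0 := prime_gt0 p_pr.
have xiE i : x ^ i = 1 + i * (p * y) %[mod p ^ 2].
  elim: i => [|i IHi]; first by rewrite expn0 mul0n.
  rewrite expnS -modnMmr IHi modnMmr xE.
  have -> : (1 + p * y) * (1 + i * (p * y)) =
            i * y ^ 2 * p ^ 2 + (1 + i.+1 * (p * y)) by ring.
  by rewrite modnMDl.
have sE : \sum_(i < p) x ^ i = p %[mod p ^ 2].
  rewrite -modn_summ; under eq_bigr => i _ do rewrite xiE.
  rewrite modn_summ big_split /= sum_nat_const card_ord muln1 -big_distrl /=.
  rewrite -(big_mkord xpredT (fun i => i)) bin2_sum bin2odd //.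
  have -> : p + p * p.-1./2 * (p * y) = p.-1./2 * y * p ^ 2 + p by ring.
  by rewrite modnMDl.
have s_gt0 : 0 < \sum_(i < p) x ^ i.
  by case: (p) p_gt0 => // q _; rewrite big_ord_recl expn0.
apply/eqP; rewrite eqn_leq; apply/andP; split.
  rewrite leqNgt -pfactor_dvdn // /dvdn sE -/(dvdn _ _).
  by rewrite -{2}(expn1 p) dvdn_Pexp2l // prime_gt1.
rewrite -pfactor_dvdn // expn1.
have := dvdn_exp2l p (isT : 1 <= 2); rewrite expn1 => pp2.
have := modn_dvdm (\sum_(i < p) x ^ i) pp2.
by rewrite sE modn_dvdm // modnn => /esym/eqP.
Qed.

(** Lifting the exponent: a factor p of j multiplies x^j - 1 by a geometric sum
    with p terms, of valuation one; a factor prime to p multiplies it by a sum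
    that is prime to p. *)
Lemma logn_expB1 (p x j : nat) :
  prime p -> odd p -> 1 < x -> p %| x - 1 -> 0 < j ->
  logn p (x ^ j - 1) = logn p (x - 1) + logn p j.
Proof.
move=> p_pr p_odd; have p_gt1 := prime_gt1 p_pr.
elim/ltn_ind: j x => j IHj x x_gt1 px j_gt0.
have x_gt0 := ltnW x_gt1.
have fac y k : 1 < y -> 0 < k ->
  logn p (y ^ k - 1) = logn p (y - 1) + logn p (\sum_(i < k) y ^ i).
  move=> y_gt1 k_gt0; rewrite !subn1 predn_exp lognM //; first by lia.
  by case: k k_gt0 => // k _; rewrite big_ord_recl expn0.
have [/dvdnP[k jE]|pNj] := boolP (p %| j).
  have k_gt0 : 0 < k by rewrite lt0n; apply: contraTneq j_gt0 => k0; rewrite jE k0.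
  have xk_gt1 : 1 < x ^ k by rewrite -(exp1n k) ltn_exp2r.
  rewrite jE expnM fac ?prime_gt0 // geom_sum_logn_prime //; last first.
  - by apply: dvdn_trans px _; rewrite -{1}(expn1 x) expnB1_dvd.
  - by rewrite ltnW.
  rewrite IHj //; last by rewrite jE ltn_Pmulr.
  by rewrite (lognM p k_gt0 (prime_gt0 p_pr)) (logn_prime p p_pr) eqxx addnA.
rewrite fac // !(@lognE _ j) (negPf pNj) !andbF (lognE p (\sum_(i < _) _)).
by rewrite [p %| _]/dvdn geom_sum_mod // -/(dvdn _ _) (negPf pNj) !andbF.
Qed.

(** * Radicals *)

Lemma rad_gt0 n : 0 < Defs.rad n.
Proof.
rewrite /Defs.rad big_seq prodn_cond_gt0 // => p.
by rewrite mem_primes => /andP[/prime_gt0].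
Qed.

Lemma logn_rad (p n : nat) : logn p (Defs.rad n) = (p \in primes n).
Proof.
rewrite /Defs.rad; have := primes_uniq n.
have : all prime (primes n) by apply/allP => q; rewrite mem_primes => /andP[].
elim: (primes n) => [|q s IHs] /=; first by rewrite big_nil logn1.
move=> /andP[q_pr s_pr] /andP[qNs s_uniq].
have s_gt0 : 0 < \prod_(r <- s) r.
  by rewrite big_seq prodn_cond_gt0 // => r /(allP s_pr)/prime_gt0.
rewrite big_cons (lognM p (prime_gt0 q_pr) s_gt0) IHs // (logn_prime p q_pr) inE.
by case: eqVneq => [->|] //; rewrite (negPf qNs).
Qed.

Lemma dvdn_logn (m n : nat) : 0 < m -> 0 < n ->
  (forall p, prime p -> logn p m <= logn p n) -> m %| n.
Proof.
move=> m_gt0 n_gt0 mn; apply/dvdn_partP => // p.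
rewrite mem_primes => /andP[p_pr _].
by rewrite p_part pfactor_dvdn // mn.
Qed.

Lemma mersenne_gt0 (n : nat) : 0 < n -> 0 < 2 ^ n - 1.
Proof. by move=> n_gt0; rewrite subn_gt0 -[X in X < _](exp1n n) ltn_exp2r. Qed.

Lemma rad_mersenne_triple (n : nat) : 0 < n ->
  Defs.rad (1 * (2 ^ n - 1) * 2 ^ n) = 2 * Defs.rad (2 ^ n - 1).
Proof.
move=> n_gt0; rewrite mul1n.
have M_gt0 := mersenne_gt0 n n_gt0.
have P2 : primes (2 ^ n) = [:: 2] by rewrite primesX.
rewrite /Defs.rad (perm_big (2 :: primes (2 ^ n - 1))) ?big_cons //.
apply: uniq_perm; rewrite ?primes_uniq //=.
  rewrite primes_uniq andbT mem_primes /= M_gt0 /= dvdn2 oddB ?expn_gt0 //.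
  by rewrite oddX /= orbF; case: n n_gt0 {M_gt0 P2}.
by move=> p; rewrite primesM ?expn_gt0 // P2 !inE orbC.
Qed.

(** * The order core *)

Lemma ord2_dvd (p k : nat) : prime p -> odd p -> (ord2 p %| k) = (p %| 2 ^ k - 1).
Proof.
move=> p_pr p_odd; have p_gt1 := prime_gt1 p_pr.
have p2 : coprime p 2 by rewrite coprimen2.
rewrite /ord2 order_dvdn -val_eqE FinRing.val_unitX insubdK; last first.
  by rewrite unfold_in -/(_ \is a GRing.unit) unitZpE.
rewrite -natrX -(eqn_mod_dvd p) ?expn_gt0 //.
by rewrite -val_eqE /= val_Zp_nat // -(val_Zp_nat p_gt1 1).
Qed.

Lemma order_core_dvdP (m k : nat) :
  order_core m %| k = all (fun p => ord2 p %| k) (wieferich_divisors m).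
Proof.
rewrite /order_core; elim: (wieferich_divisors m) => [|p s IHs].
  by rewrite big_nil dvd1n.
by rewrite big_cons dvdn_lcm IHs.
Qed.

Lemma mem_wieferich_divisors (m p : nat) : 0 < m ->
  (p \in wieferich_divisors m) = wieferich p && (p %| 2 ^ m - 1).
Proof.
move=> m_gt0; rewrite mem_filter mem_primes mersenne_gt0 //=.
by rewrite /wieferich; case: (prime p).
Qed.

Lemma order_core_dvd (m : nat) : 0 < m -> order_core m %| m.
Proof.
move=> m_gt0; rewrite order_core_dvdP; apply/allP => p.
rewrite mem_wieferich_divisors // => /andP[/and3P[p_pr p_odd _]].
by rewrite ord2_dvd.
Qed.

Lemma order_core_gt0 (m : nat) : 0 < m -> 0 < order_core m.
Proof. by move=> m_gt0; apply: dvdn_gt0 (order_core_dvd m m_gt0). Qed.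

(** The order of 2 modulo p divides the core as soon as it divides m, so passing
    to the core keeps every Wieferich divisor. *)
Lemma wieferich_dvd_core (m p : nat) : 0 < m -> wieferich p ->
  (p %| 2 ^ order_core m - 1) = (p %| 2 ^ m - 1).
Proof.
move=> m_gt0 p_wief; have /and3P[p_pr p_odd _] := p_wief.
apply/idP/idP => [pD | pm].
  by apply: dvdn_trans pD _; rewrite expnB1_dvd // order_core_dvd.
rewrite -ord2_dvd //.
have := dvdnn (order_core m); rewrite {1}order_core_dvdP => /allP; apply.
by rewrite mem_wieferich_divisors // p_wief.
Qed.

(** The core is determined by the Wieferich divisors, which are the same for m
    and for its core. *)
Lemma order_core_saturated (m : nat) : 0 < m ->
  order_core (order_core m) = order_core m.
Proof.
move=> m_gt0; have D_gt0 := order_core_gt0 m m_gt0.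
apply/eqP; rewrite eqn_dvd order_core_dvd //= order_core_dvdP.
apply/allP => p; rewrite mem_wieferich_divisors // => /andP[p_wief].
rewrite -wieferich_dvd_core // -wieferich_dvd_core //.
by rewrite ord2_dvd //; case/and3P: p_wief.
Qed.

(** Here p divides 2^(p-1) - 1 exactly once, and 2^m - 1 divides
    2^((p-1)m) - 1, whose valuation is then 1 + v_p(m). Taking the exponent
    p - 1 in place of the order of 2 modulo p costs nothing, p - 1 being prime
    to p. *)
Lemma non_wieferich_logn (m p : nat) : 0 < m -> prime p -> odd p ->
  ~~ wieferich p -> logn p (2 ^ m - 1) <= 1 + logn p m.
Proof.
move=> m_gt0 p_pr p_odd; rewrite /wieferich p_pr p_odd /= eqn_mod_dvd ?expn_gt0 //.
have p_gt2 : 2 < p by case: p p_odd p_pr => [|[|[|]]].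
have p1_gt0 : 0 < p - 1 by lia.
rewrite pfactor_dvdn ?mersenne_gt0 // -ltnNge ltnS => le1.
have p_dvd : p %| 2 ^ (p - 1) - 1.
  rewrite -eqn_mod_dvd ?expn_gt0 // subn1 -totient_prime //; apply/eqP.
  by apply: Euler_exp_totient; rewrite coprime2n.
have x_gt1 : 1 < 2 ^ (p - 1) by rewrite -subn_gt0 mersenne_gt0.
apply: (@leq_trans (logn p (2 ^ ((p - 1) * m) - 1))).
  apply: dvdn_leq_log; first by rewrite mersenne_gt0 // muln_gt0 p1_gt0.
  by rewrite expnB1_dvd // dvdn_mull.
by rewrite expnM logn_expB1 // leq_add2r.
Qed.

(** With F(n) the quotient of 2^n - 1 by its radical, this is the statement that
    F(m) divides m F(D) for the core D, with denominators cleared. *)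
Lemma nonradical_part_dvd (m : nat) : 0 < m ->
  (2 ^ m - 1) * Defs.rad (2 ^ order_core m - 1)
    %| m * (2 ^ order_core m - 1) * Defs.rad (2 ^ m - 1).
Proof.
move=> m_gt0; set D := order_core m.
have D_gt0 : 0 < D := order_core_gt0 m m_gt0.
have Dm : D %| m := order_core_dvd m m_gt0.
have Mm := mersenne_gt0 m m_gt0; have MD := mersenne_gt0 D D_gt0.
apply: dvdn_logn; rewrite ?muln_gt0 ?Mm ?MD ?m_gt0 ?rad_gt0 // => p p_pr.
rewrite !lognM ?muln_gt0 ?rad_gt0 ?m_gt0 //.
rewrite !logn_rad !mem_primes p_pr Mm MD /=.
have [pm|pNm] := boolP (p %| 2 ^ m - 1); last first.
  have pND : ~~ (p %| 2 ^ D - 1).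
    by apply: contra pNm => pD; apply: dvdn_trans pD (expnB1_dvd _ _ _ Dm).
  by rewrite (negPf pND) (lognE p (2 ^ m - 1)) (negPf pNm) !andbF.
have p_odd : odd p.
  have [p2|//] := even_prime p_pr; move: pm; rewrite p2 dvdn2 oddB ?expn_gt0 //.
  by rewrite oddX /= orbF; case: (m) m_gt0.
have [pD|pND] := boolP (p %| 2 ^ D - 1).
  have [j mE] := dvdnP Dm; have j_gt0 : 0 < j.
    by move: m_gt0; rewrite mE muln_gt0 => /andP[].
  have xD_gt1 : 1 < 2 ^ D by rewrite -subn_gt0.
  rewrite {1}mE mulnC expnM logn_expB1 // leq_add2r addnC leq_add2r.
  by rewrite mE lognM // leq_addr.
have p_nwief : ~~ wieferich p.
  by apply: contra pND => p_wief; rewrite wieferich_dvd_core.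
have := non_wieferich_logn m p m_gt0 p_pr p_odd p_nwief; lia.
Qed.

(** * The logarithmic form of the excess *)

Local Open Scope classical_set_scope.
Local Open Scope ring_scope.

Lemma ln_natM (R : realType) (a b : nat) : (0 < a)%N -> (0 < b)%N ->
  ln ((a * b)%:R : R) = ln (a%:R : R) + ln (b%:R : R).
Proof. by move=> a0 b0; rewrite natrM lnM ?posrE ?ltr0n. Qed.

Lemma ln_nat_ge0 (R : realType) (a : nat) : (0 < a)%N -> 0 <= ln (a%:R : R).
Proof. by move=> a0; rewrite ln_ge0 // ler1n. Qed.

Lemma mersenne_defect_gt0 (R : realType) (n : nat) : (0 < n)%N ->
  0 < 1 - 2 ^- n :> R.
Proof.
move=> n_gt0; rewrite subr_gt0 invf_lt1 ?exprn_gt0 //.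
by rewrite exprn_egt1 // ?ltr1n // -lt0n.
Qed.

Lemma ln_mersenne (R : realType) (n : nat) : (0 < n)%N ->
  ln ((2 ^ n - 1)%N%:R : R) = n%:R * ln 2 + ln (1 - 2 ^- n : R).
Proof.
move=> n_gt0; have dgt0 := mersenne_defect_gt0 R n n_gt0.
have -> : (2 ^ n - 1)%N%:R = 2 ^+ n * (1 - 2 ^- n) :> R.
  by rewrite natrB ?expn_gt0 // natrX mulrBr mulr1 divff // expf_neq0.
rewrite lnM ?posrE ?exprn_gt0 // lnXn //.
by rewrite mulr_natl.
Qed.

Lemma excess_mersenne (R : realType) (eps : R) (n : nat) : (0 < n)%N ->
  excess eps (mersenne_triple n) =
  n%:R * ln 2 - (1 + eps) * (ln 2 + ln ((Defs.rad (2 ^ n - 1))%:R : R)).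
Proof.
move=> n_gt0; rewrite /excess /mersenne_triple rad_mersenne_triple //.
by rewrite ln_natM ?rad_gt0 // natrX lnXn // mulr_natl.
Qed.

Lemma ln_nonradical_part (R : realType) (m : nat) : (0 < m)%N ->
  m%:R * ln 2 + ln (1 - 2 ^- m : R)
    + ln ((Defs.rad (2 ^ order_core m - 1))%:R : R) <=
  ln m%:R + ((order_core m)%:R * ln 2 + ln (1 - 2 ^- order_core m))
    + ln ((Defs.rad (2 ^ m - 1))%:R : R).
Proof.
move=> m_gt0; set D := order_core m.
have D_gt0 : (0 < D)%N := order_core_gt0 m m_gt0.
have Mm := mersenne_gt0 m m_gt0; have MD := mersenne_gt0 D D_gt0.
rewrite -!ln_mersenne // -!ln_natM ?muln_gt0 ?m_gt0 ?rad_gt0 //.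
rewrite ler_ln ?posrE ?ltr0n ?muln_gt0 ?m_gt0 ?Mm ?MD ?rad_gt0 // ler_nat.
by rewrite dvdn_leq ?nonradical_part_dvd // !muln_gt0 m_gt0 MD rad_gt0.
Qed.

(** The inequality F(m) <= m F(D) in logarithms, combined with the lower bound on
    ln F(m) that the excess at m provides. Both the hypothesis and
    [ln_nonradical_part] enter with weight 1 + eps, after which the excess at D is
    the sum of three nonnegative terms. *)
Lemma excess_core_ge0_ln (R : realType) (eps : R) (m : nat) :
  0 < eps -> (0 < m)%N ->
  0 <= excess eps (mersenne_triple m) ->
  ln m%:R + ln (1 - 2 ^- order_core m) - ln (1 - 2 ^- m)
    <= eps / (1 + eps) * (m%:R - (order_core m)%:R) * ln 2 ->
  0 <= excess eps (mersenne_triple (order_core m)).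
Proof.
move=> eps_gt0 m_gt0 +; set D := order_core m.
have D_gt0 : (0 < D)%N := order_core_gt0 m m_gt0.
rewrite !excess_mersenne //; move: (ln_nonradical_part R m m_gt0) => /=; rewrite -/D.
have e1 : 0 < 1 + eps by rewrite addr_gt0.
move: (ln 2) (ln m%:R) (ln (1 - 2 ^- m)) (ln (1 - 2 ^- D)) => L l u v.
move: (ln _) (ln _) => A B key Em cond.
have {}key : 0 <= (1 + eps) * (l + (D%:R * L + v) + A - (m%:R * L + u + B)).
  by apply: mulr_ge0; rewrite ?subr_ge0 // ltW.
have {}cond : 0 <= (1 + eps) * (eps / (1 + eps) * (m%:R - D%:R) * L - (l + v - u)).
  by apply: mulr_ge0; rewrite ?subr_ge0 // ltW.
have E : (1 + eps) * (eps / (1 + eps) * (m%:R - D%:R) * L - (l + v - u)) =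
   eps * (m%:R - D%:R) * L - (1 + eps) * (l + v - u) by field; rewrite gt_eqF.
rewrite {}E in cond; apply: (le_trans (addr_ge0 (addr_ge0 key cond) Em)).
by rewrite le_eqVlt; apply/orP; left; apply/eqP; ring.
Qed.

Lemma excess_core_ge0 (R : realType) (eps : R) (m : nat) :
  0 < eps -> (0 < m)%N ->
  0 <= excess eps (mersenne_triple m) ->
  m%:R * ((1 - 2 ^- order_core m) / (1 - 2 ^- m))
    <= 2 `^ (eps / (1 + eps) * (m%:R - (order_core m)%:R)) ->
  0 <= excess eps (mersenne_triple (order_core m)).
Proof.
move=> eps_gt0 m_gt0 Em; set D := order_core m.
have D_gt0 : (0 < D)%N := order_core_gt0 m m_gt0.
have dm := mersenne_defect_gt0 R m m_gt0; have dD := mersenne_defect_gt0 R D D_gt0.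
move=> cond; apply: excess_core_ge0_ln => //; rewrite -ln_powR -/D -addrA.
have q_gt0 : 0 < (1 - 2 ^- D) / (1 - 2 ^- m) :> R by rewrite divr_gt0.
rewrite -ln_div ?posrE // -lnM ?posrE ?ltr0n //.
by rewrite ler_ln ?posrE ?powR_gt0 // mulr_gt0 // ltr0n.
Qed.

Lemma excess_core_ge0_simple (R : realType) (eps : R) (m : nat) :
  0 < eps -> (0 < m)%N ->
  0 <= excess eps (mersenne_triple m) ->
  m%:R <= 2 `^ (eps / (1 + eps) * (m%:R - (order_core m)%:R)) ->
  0 <= excess eps (mersenne_triple (order_core m)).
Proof.
move=> eps_gt0 m_gt0 Em; set D := order_core m => le2.
apply: excess_core_ge0 => //; apply: le_trans le2.
have D_le_m : (D <= m)%N by rewrite dvdn_leq // order_core_dvd.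
rewrite -[leRHS]mulr1 ler_wpM2l // ler_pdivrMr ?mersenne_defect_gt0 // mul1r.
by rewrite lerD2l lerN2 lef_pV2 ?posrE ?exprn_gt0 // ler_weXn2l // ler1n.
Qed.

(** The nonradical part of 2^D - 1 is at most 2^D, whereas transgression at m
    forces the one of 2^m - 1 to be at least 2^(theta m); the factor m between
    them accounts for ln m. *)
Lemma transgressive_core_growth (R : realType) (eps : R) (m : nat) :
  0 < eps -> (0 < m)%N ->
  0 <= excess eps (mersenne_triple m) ->
  eps / (1 + eps) * m%:R * ln 2 <= ln m%:R + (order_core m)%:R * ln (2 : R).
Proof.
move=> eps_gt0 m_gt0; have D_gt0 := order_core_gt0 m m_gt0.
rewrite excess_mersenne //; move: (ln_nonradical_part R m m_gt0) => /=.
have : 0 <= ln ((Defs.rad (2 ^ order_core m - 1))%:R : R).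
  by rewrite ln_nat_ge0 ?rad_gt0.
have : ln (1 - 2 ^- order_core m : R) <= 0.
  by rewrite ln_le0 // gerBl invr_ge0 exprn_ge0.
have : 0 <= ln 2 + ln (1 - 2 ^- m : R).
  have dm := mersenne_defect_gt0 R m m_gt0.
  rewrite -lnM ?posrE // ln_ge0 //.
  have : 2 ^- m <= 2 ^- 1 :> R.
    by rewrite lef_pV2 ?posrE ?exprn_gt0 // ler_weXn2l // ler1n.
  rewrite expr1; lra.
have e1 : 0 < 1 + eps by rewrite addr_gt0.
move: (ln 2) (ln m%:R) (ln (1 - 2 ^- m)) (ln (1 - 2 ^- order_core m)) => L l u v.
move: (ln _) (ln _) => A B u0 v0 B0 key Em.
have {}Em : 0 <= m%:R * L / (1 + eps) - (L + A).
  suff -> : m%:R * L / (1 + eps) - (L + A) =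
            (m%:R * L - (1 + eps) * (L + A)) / (1 + eps).
    by rewrite divr_ge0 // ltW.
  by field; rewrite gt_eqF.
have -> : eps / (1 + eps) * m%:R * L = m%:R * L - m%:R * L / (1 + eps).
  by field; rewrite gt_eqF.
lra.
Qed.

(** * Infinite transgressive families *)

Lemma ln_nat_le_linear (R : realType) (a K : R) : 0 < a ->
  exists N : nat, forall m : nat, (N <= m)%N -> ln m%:R + K <= a * m%:R.
Proof.
move=> a_gt0; pose b := a / 2; have b_gt0 : 0 < b by rewrite divr_gt0.
(* Since ln (m b) < m b with b = a / 2, half of the slope absorbs ln m, up to
   the constant ln b, and the other half absorbs K - ln b. *)
exists (Num.Def.archi_bound ((K - ln b) / b)).+1 => m Nm.
have m_gt0 : 0 < m%:R :> R by rewrite ltr0n; apply: leq_trans Nm.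
have : ln (m%:R * b) < m%:R * b by rewrite ln_sublinear // mulr_gt0.
rewrite lnM ?posrE // => lt1.
have lt2 : K - ln b < m%:R * b.
  rewrite -ltr_pdivrMr //; apply: lt_le_trans (unstable.ltr_bound _) _.
  by rewrite ler_nat ltnW.
have -> : a * m%:R = m%:R * b + m%:R * b by rewrite /b; field.
lra.
Qed.

Lemma infinite_natP (A : set nat) :
  infinite_set A <-> forall N : nat, exists2 m, (N <= m)%N & A m.
Proof.
split=> [Ainf N | Aunb Afin].
  have [m [Am /negP]] := infinite_setN0 (infinite_setD Ainf (finite_II N)).
  by rewrite -leqNgt; exists m.
have [s AE] := (finite_seqP A).1 Afin.
have [m ms] := Aunb (\max_(i <- s) i).+1%N; rewrite AE /= => m_in.
by move: ms; rewrite ltnNge (leq_bigmax_seq m).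
Qed.

(** The cores of the transgressive exponents form the saturated family: the core
    of a large transgressive m is itself transgressive, and it is unbounded. *)
Lemma infinite_saturated (R : realType) (eps : R) : 0 < eps ->
  infinite_set
    [set m : nat | (2 <= m)%N /\ 0 <= excess eps (mersenne_triple m)] ->
  infinite_set
    [set n : nat | [/\ (2 <= n)%N, order_saturated n
                     & 0 <= excess eps (mersenne_triple n)]].
Proof.
move=> eps_gt0 /infinite_natP Minf; apply/infinite_natP => N.
have L_gt0 : 0 < ln 2 :> R by rewrite ln_gt0 // ltr1n.
have t_gt0 : 0 < eps / (1 + eps) by rewrite divr_gt0 // addr_gt0.
(* Beyond N1 the core is at least N and at least 2. *)
have [N1 H1] := @ln_nat_le_linear R (eps / (1 + eps) * ln 2)
  ((maxn N 2)%:R * ln 2) (mulr_gt0 t_gt0 L_gt0).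
(* Beyond N2 one has m <= 2^(theta m / 2), the criterion when D <= m / 2. *)
have [N2 H2] := @ln_nat_le_linear R (eps / (1 + eps) * ln 2 / 2) 0
  (divr_gt0 (mulr_gt0 t_gt0 L_gt0) (ltr0Sn R 1)).
have [m Nm [m_ge2 Em]] := Minf (maxn N1 N2).
move: Nm; rewrite geq_max => /andP[/H1 {}H1 /H2 {}H2].
have m_gt0 : (0 < m)%N by exact: ltnW.
have D_gt0 := order_core_gt0 m m_gt0.
have := transgressive_core_growth R eps m eps_gt0 m_gt0 Em.
rewrite mulrAC => gr.
have : (maxn N 2 <= order_core m)%N.
  rewrite -(ler_nat R) -(ler_pM2r L_gt0); lra.
rewrite geq_max => /andP[ND D2].
exists (order_core m) => //; split=> //; first exact: order_core_saturated.
have := dvdn_leq m_gt0 (order_core_dvd m m_gt0).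
rewrite leq_eqVlt => /orP[/eqP-> //|Dm].
have [j mE] := dvdnP (order_core_dvd m m_gt0).
have D2m : (2 * order_core m <= m)%N.
  rewrite [leqRHS]mE leq_mul2r; move: mE Dm; move: (order_core m) => D.
  by case: j => [|[|j]] ->; rewrite ?mul0n ?mul1n ?ltnn ?orbT.
apply: excess_core_ge0_simple => //.
rewrite -ler_ln ?posrE ?powR_gt0 ?ltr0n // ln_powR.
move: D2m; rewrite -(ler_nat R) natrM => D2m.
rewrite addr0 in H2; apply: le_trans H2 _.
have -> : eps / (1 + eps) * ln 2 / 2 * m%:R =
           eps / (1 + eps) * (m%:R / 2) * ln 2 by ring.
by rewrite ler_pM2r // ler_pM2l //; lra.
Qed.

Theorem theorem6p39 (R : realType) (eps : R) (eps_gt0 : 0 < eps) :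
  let theta : R := eps / (1 + eps) in
  (forall m : nat, (2 <= m)%N -> wieferich_supported m ->
     0 <= excess eps (mersenne_triple m) ->
     let D := order_core m in
     [/\ D = m -> order_saturated m,
         (D < m)%N ->
           m%:R * ((1 - 2 ^- D) / (1 - 2 ^- m))
             <= 2 `^ (theta * (m%:R - D%:R)) ->
           0 <= excess eps (mersenne_triple D)
       & (D < m)%N ->
           m%:R <= 2 `^ (theta * (m%:R - D%:R)) ->
           0 <= excess eps (mersenne_triple D)]) /\
  (infinite_set
     [set m : nat | (2 <= m)%N /\ 0 <= excess eps (mersenne_triple m)] <->
   infinite_set
     [set n : nat | [/\ (2 <= n)%N, order_saturated n
                      & 0 <= excess eps (mersenne_triple n)]]) /\
  (forall S : set nat, infinite_set S ->
     (forall m, S m ->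
        (2 <= m)%N /\ 0 <= excess eps (mersenne_triple m)) ->
     exists2 T : set nat, infinite_set T &
       forall n, T n ->
         [/\ (2 <= n)%N, order_core n = n
           & 0 <= excess eps (mersenne_triple n)]).
Proof.
move=> theta; split; [|split].
- move=> m m_ge2 _ Em D; have m_gt0 := ltnW m_ge2.
  split=> // _ cond; first exact: excess_core_ge0 cond.
  exact: excess_core_ge0_simple cond.
- split; first exact: infinite_saturated.
  by apply: sub_infinite_set => n [].
- move=> S Sinf SE.
  exists [set n : nat | [/\ (2 <= n)%N, order_saturated n
                          & 0 <= excess eps (mersenne_triple n)]] => //.
  by apply: infinite_saturated => //; apply: sub_infinite_set Sinf.
Qed.
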